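(* Consider an instance $(D,B,\gamma)$ of the periodic aircraft routing problem with $\gamma \leq 4$. If the problem is feasible, then there exists an absolutely periodic solution.
   Context: An instance of the periodic aircraft routing problem consists of an Eulerian directed graph $D=(V,A)$ (parallel arcs allowed; every vertex has equal in- and outdegree), a subset $B \subseteq V$, and an integer $\gamma \geq 1$. Let $m=|A|$. A solution is a collection of $m$ semi-infinite walks $W_1,\ldots,W_m$ (walks with a first vertex and infinitely many subsequent arcs) such that (1) each walk visits $B$ infinitely many times, with at most $\gamma$ arcs between two visits, and (2) for every $j=1,2,\ldots$, the $j$th arcs of $W_1,\ldots,W_m$ are pairwise distinct and together form $A$. The problem is feasible if a solution exists. A solution is periodic if each $W_i$ is periodic. It is absolutely periodic if each $W_i$ is periodic and does not use the same arc twice within a period (so each $W_i$ repeatedly follows a fixed closed directed trail), and moreover every two walks $W_i$, $W_{i'}$ are either (arc-)disjoint or identical (follow the same closed directed trail). Equivalently, an absolutely periodic solution corresponds to a partition of $A$ into closed directed trails each visiting $B$ at least once every $\gamma$ arcs. *)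

(* Defs.v *)
From mathcomp Require Import all_boot.

Set Implicit Arguments.
Unset Strict Implicit.
Unset Printing Implicit Defensive.

(* Finite directed multigraph: parallel arcs (and loops) are allowed. *)
Record digraph := Digraph {
  vertex : finType;
  darc : finType;
  source : darc -> vertex;
  target : darc -> vertex
}.

Definition indegree (D : digraph) (v : vertex D) : nat :=
  #|[set a : darc D | target a == v]|.

Definition outdegree (D : digraph) (v : vertex D) : nat :=
  #|[set a : darc D | source a == v]|.

Definition eulerian (D : digraph) : Prop :=
  forall v : vertex D, indegree v = outdegree v.

(* A semi-infinite walk is given by its sequence of arcs, indexed from 0; its
   k-th vertex is then the source of its k-th arc. *)
Definition is_walk (D : digraph) (w : nat -> darc D) : Prop :=
  forall k, target (w k) = source (w k.+1).

Definition walk_vertex (D : digraph) (w : nat -> darc D) (k : nat) : vertex D :=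
  source (w k).

Definition visits_infinitely_often (D : digraph) (B : {set vertex D})
    (w : nat -> darc D) : Prop :=
  forall n, exists2 k, n <= k & walk_vertex w k \in B.

Definition consecutive_visits (D : digraph) (B : {set vertex D})
    (w : nat -> darc D) (i j : nat) : Prop :=
  [/\ i < j, walk_vertex w i \in B, walk_vertex w j \in B &
      forall k, i < k < j -> walk_vertex w k \notin B].

(* There are j - i arcs between the visits at positions i < j.  The part of the
   walk preceding its first visit to B is unconstrained. *)
Definition visits_regularly (D : digraph) (B : {set vertex D}) (gamma : nat)
    (w : nat -> darc D) : Prop :=
  visits_infinitely_often B w /\
  forall i j, consecutive_visits B w i j -> j - i <= gamma.

Definition is_solution (D : digraph) (B : {set vertex D}) (gamma : nat)
    (W : 'I_#|darc D| -> nat -> darc D) : Prop :=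
  [/\ forall i, is_walk (W i),
      forall i, visits_regularly B gamma (W i) &
      forall j, injective (fun i => W i j) /\
                forall a : darc D, exists i, W i j = a].

Definition feasible (D : digraph) (B : {set vertex D}) (gamma : nat) : Prop :=
  exists W : 'I_#|darc D| -> nat -> darc D, is_solution B gamma W.

Definition is_period (D : digraph) (w : nat -> darc D) (p : nat) : Prop :=
  0 < p /\ forall k, w (k + p) = w k.

(* For a walk w, the arcs w 0, ..., w (p - 1) then form a closed directed trail
   that w follows repeatedly. *)
Definition trail_periodic (D : digraph) (w : nat -> darc D) : Prop :=
  exists2 p, is_period w p &
    forall j k, j < p -> k < p -> w j = w k -> j = k.

Definition arc_disjoint (D : digraph) (w w' : nat -> darc D) : Prop :=
  forall j k, w j <> w' k.

(* Two walks following the same closed trail may start at different places of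
   it: distinct walks of a solution never use the same arc simultaneously, so
   "identical" has to be read up to a shift.  On periodic walks this relation
   is symmetric. *)
Definition same_closed_trail (D : digraph) (w w' : nat -> darc D) : Prop :=
  exists s, forall k, w' k = w (k + s).

Definition absolutely_periodic (D : digraph)
    (W : 'I_#|darc D| -> nat -> darc D) : Prop :=
  (forall i, trail_periodic (W i)) /\
  forall i i', arc_disjoint (W i) (W i') \/ same_closed_trail (W i) (W i').

(* Main.v *)
(** Call an arc inner if both its ends lie outside B.  Since gamma <= 4, a walk
    uses at most two inner arcs between two visits of B.  Freeze a feasible
    solution at a late time and let S be the set of inner arcs that come
    immediately after an arc leaving B.  At a vertex v outside B, let n(v) be the
    number of arcs from B into v.  Then S has at most n(v) arcs leaving v and at
    least o(v) - n(v) arcs entering v, where o(v) is the number of inner arcs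
    leaving v.  Enlarging S preserves the second bound, so take S maximal subject
    to the first: each v now has n(v) arcs of S leaving it, or all of its o(v)
    inner arcs.  Hence the arcs of S leaving v can be matched to arcs from B into
    v, and the other inner arcs leaving v to arcs of S entering v.  Completing
    this matching to a permutation of the arcs, its orbits are the closed
    trails. *)

Require Import Defs.
From mathcomp Require Import all_boot.
From mathcomp Require Import zify.

Set Implicit Arguments.
Unset Strict Implicit.
Unset Printing Implicit Defensive.

(** * Injections between finite sets that respect labels *)

Section FiberwiseInjections.

Variables (T K : finType) (f g : T -> K).

(** In each fibre, the element at a given index of the [f]-side goes to the element at the same
    index of the [g]-side; the cardinality bound keeps the index in range. *)
Lemma fiberwise_injection (A B : {set T}) :
  (forall k, #|[set x in A | f x == k]| <= #|[set y in B | g y == k]|) ->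
  exists2 h : T -> T, {in A &, injective h} &
    forall x, x \in A -> h x \in B /\ g (h x) = f x.
Proof.
move=> leAB.
pose FA k := enum [set x in A | f x == k].
pose FB k := enum [set y in B | g y == k].
pose h x := nth x (FB (f x)) (index x (FA (f x))).
have idx x : x \in A -> index x (FA (f x)) < size (FB (f x)).
  move=> xA; rewrite -cardE; apply: leq_trans (leAB _).
  by rewrite cardE index_mem mem_enum !inE xA eqxx.
have hP x : x \in A -> h x \in B /\ g (h x) = f x.
  move=> xA; have: h x \in FB (f x) by rewrite mem_nth ?idx.
  by rewrite mem_enum !inE => /andP[-> /eqP].
exists h => // x y xA yA hxy.
have fxy : f x = f y by rewrite -(hP x xA).2 hxy (hP y yA).2.
have eq_idx : index x (FA (f x)) = index y (FA (f y)).
  apply/eqP; rewrite -(nth_uniq x (idx x xA) _ (enum_uniq _)); last first.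
    by rewrite fxy idx.
  (* The defaults [x] and [y] of the two [nth] differ, but the index is in range. *)
  have := hxy; rewrite /h => ->; apply/eqP; rewrite fxy.
  by apply: set_nth_default; rewrite idx.
have xF : x \in FA (f x) by rewrite mem_enum !inE xA eqxx.
have yF : y \in FA (f y) by rewrite mem_enum !inE yA eqxx.
by rewrite -(nth_index x xF) -[RHS](nth_index x yF) eq_idx fxy.
Qed.

(** [h] uses up equally many elements of the [f]-fibre and the [g]-fibre over each label, so the
    remainders are again equinumerous and can be matched. *)
Lemma extend_fiberwise_injection (X : {set T}) (h : T -> T) :
  (forall k, #|[set x | f x == k]| = #|[set y | g y == k]|) ->
  {in X &, injective h} -> {in X, forall x, g (h x) = f x} ->
  exists h' : T -> T,
    [/\ injective h', forall x, g (h' x) = f x & {in X, h' =1 h}].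
Proof.
move=> eqfg hI hfg.
have [|h2 h2I h2P] := @fiberwise_injection (~: X) (~: (h @: X)).
  move=> k; have := eqfg k.
  rewrite -(cardsID X) -(cardsID (h @: X) [set y | g y == k]).
  have -> : [set y | g y == k] :&: h @: X = h @: ([set x | f x == k] :&: X).
    apply/setP=> y; rewrite !inE; apply/andP/imsetP.
      move=> [/eqP gy /imsetP[x xX yE]]; exists x => //.
      by rewrite !inE xX andbT -(hfg x xX) -yE gy.
    by move=> [x]; rewrite !inE => /andP[/eqP <- xX] ->; rewrite hfg ?imset_f.
  rewrite card_in_imset => [/addnI|x y /setIP[_ xX] /setIP[_ yX]]; last exact: hI.
  by rewrite !setDE ![_ :&: ~: _]setIC !setIdE => ->.
exists (fun x => if x \in X then h x else h2 x); split=> [x y|x|x ->] //; last first.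
  by case: ifPn => [/hfg // | xX]; apply: (h2P x _).2; rewrite inE.
case: ifPn => xX; case: ifPn => yX; first exact: hI.
- move=> e; have [] := h2P y; first by rewrite inE.
  by rewrite -e !inE imset_f.
- move=> e; have [] := h2P x; first by rewrite inE.
  by rewrite e !inE imset_f.
- by apply: h2I; rewrite inE.
Qed.

End FiberwiseInjections.

(** * Runs outside [B] and successor permutations *)

Section Routing.

Variables (D : digraph) (B : {set vertex D}).

Definition inner_arcs : {set darc D} :=
  [set a | (source a \notin B) && (target a \notin B)].

Definition arcs_from_B : {set darc D} := [set a | source a \in B].

(** The last visit up to [m] and the first one from [m] on are consecutive and enclose [k.+1]
    vertices outside [B]. The earlier visit is required since nothing bounds the walk before its
    first visit. *)
Lemma outside_run_short gamma (w : nat -> darc D) m k :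
  visits_regularly B gamma w -> (exists2 n, n <= m & source (w n) \in B) ->
  (forall l, l <= k -> source (w (m + l)) \notin B) -> k.+2 <= gamma.
Proof.
move=> [winf wgap] [n nm nB] out.
have exi : exists i, (i <= m) && (source (w i) \in B) by exists n; rewrite nm.
have exj : exists j, (m <= j) && (source (w j) \in B).
  by have [j mj jB] := winf m; exists j; rewrite mj.
have ubi i : (i <= m) && (source (w i) \in B) -> i <= m by case/andP.
case: (ex_maxnP exi ubi) => i /andP[im iB] imax.
case: (ex_minnP exj) => j /andP[mj jB] jmin.
have i_ltm : i < m.
  by rewrite ltn_neqAle im andbT; apply: contraTneq iB => ->; rewrite -(addn0 m) out.
have j_gt : m + k < j.
  rewrite ltnNge; apply: contraL jB => jk.
  by rewrite -(subnKC mj) out // leq_subLR.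
have: j - i <= gamma.
  apply: wgap; split=> //; first exact: leq_trans i_ltm mj.
  move=> l /andP[il lj]; apply/negP => lB.
  have [lm|ml] := leqP l m.
    by move: (imax l); rewrite lm lB leqNgt il => /(_ isT).
  by move: (jmin l); rewrite (ltnW ml) lB leqNgt lj => /(_ isT).
lia.
Qed.

(* The permutation [p] is built backwards: each inner arc of [S] is preceded by
   an arc leaving [B], each other inner arc by an arc of [S], and this partial
   predecessor map is completed using that [D] is Eulerian. *)
Lemma exists_routing gamma (S : {set darc D}) :
  eulerian D -> 1 <= gamma <= 4 -> S \subset inner_arcs ->
  (forall v, #|[set a in S | source a == v]|
             <= #|[set a in arcs_from_B | target a == v]|) ->
  (forall v, #|[set a in inner_arcs :\: S | source a == v]|
             <= #|[set a in S | target a == v]|) ->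
  (forall a : darc D, source a \notin B -> 2 <= gamma) ->
  (forall a, a \in inner_arcs -> 3 <= gamma) ->
  (forall a, a \in inner_arcs :\: S -> 4 <= gamma) ->
  exists2 p : darc D -> darc D, injective p &
    (forall a, source (p a) = target a) /\
    (forall w, (forall k, w k.+1 = p (w k)) -> visits_regularly B gamma w).
Proof.
move=> eulD /andP[g1 g4] sSX degS degX out2 inn3 inn4.
have innS a : a \in S -> source a \notin B.
  by move=> /(subsetP sSX); rewrite inE => /andP[].
(* Equal labels [g b = f a] say that [b] can precede [a] and that [b] leaves [B] exactly when [a] is
   in [S]. *)
pose f a := (source a, a \in S).
pose g a := (target a, source a \in B).
have [|h1 h1I h1P] := @fiberwise_injection _ _ f g inner_arcs (arcs_from_B :|: S).
  move=> [v []].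
    apply: leq_trans (leq_trans (degS v) _); apply/subset_leq_card/subsetP => a.
      by rewrite !inE => /andP[_ /eqP[-> ->]]; rewrite eqxx.
    by rewrite !inE /g => /andP[-> /eqP ->]; rewrite eqxx.
  apply: leq_trans (leq_trans (degX v) _); apply/subset_leq_card/subsetP => a.
    by rewrite !inE => /andP[-> /eqP[-> ->]]; rewrite eqxx.
  by rewrite !inE /g => /andP[aS /eqP ->]; rewrite aS (negPf (innS _ aS)) orbT eqxx.
have h1src a : a \in inner_arcs -> target (h1 a) = source a.
  by move=> /h1P[_ []].
(* From here on only the vertex label is kept, so equal in- and outdegrees suffice. *)
have [v|h [hI hsrc hX]] := extend_fiberwise_injection _ h1I h1src.
  by rewrite -/(outdegree v) -eulD.
have hS a : a \in S -> source (h a) \in B.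
  move=> aS; have aX := subsetP sSX a aS.
  by rewrite hX //; have [_ [_ ->]] := h1P _ aX.
have hXS a : a \in inner_arcs :\: S -> h a \in S.
  rewrite inE => /andP[aS aX]; rewrite hX //.
  have [+ [_ e]] := h1P _ aX.
  by rewrite 2!inE e (negPf aS).
exists (invF hI); first by move=> a b /(congr1 h); rewrite !f_invF.
split=> [a|w wS]; first by rewrite -hsrc f_invF.
have wh k : h (w k.+1) = w k by rewrite wS f_invF.
have walk k : target (w k) = source (w k.+1) by rewrite -hsrc wh.
have inner k : source (w k) \notin B -> source (w k.+1) \notin B ->
    w k \in inner_arcs.
  by rewrite inE walk => -> ->.
have not_in_S k : source (w k) \notin B -> source (w k.+1) \notin B ->
    source (w k.+2) \notin B -> w k.+1 \in inner_arcs :\: S.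
  move=> o0 o1 o2; rewrite inE inner // andbT.
  by apply: contra o0 => /hS; rewrite wh.
(* With a fourth vertex outside [B], the arc at [k.+2] would be inner and not in [S], its
   predecessor in [S], and the arc at [k] would leave [B]. *)
have no4 k : source (w k) \notin B -> source (w k.+1) \notin B ->
    source (w k.+2) \notin B -> source (w k.+3) \in B.
  move=> o0 o1 o2; apply/negPn/negP => o3.
  have := hXS _ (not_in_S _ o1 o2 o3); rewrite wh => /hS.
  by rewrite wh (negPf o0).
split=> [n|i j [ij iB jB out]]; rewrite /walk_vertex.
  have [|o0] := boolP (source (w n) \in B); first by exists n.
  have [|o1] := boolP (source (w n.+1) \in B); first by exists n.+1.
  have [|o2] := boolP (source (w n.+2) \in B); first by exists n.+2; lia.
  by exists n.+3; [lia | apply: no4].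
rewrite leqNgt; apply/negP => gij.
have o l : 0 < l <= gamma -> source (w (l + i)) \notin B.
  by move=> lg; apply: out; lia.
(* Each lower bound on [gamma] puts one more vertex outside [B], which yields the next bound; at 4,
   [no4] is contradicted. *)
have g2 : 2 <= gamma by apply: (out2 (w (1 + i))); apply: o; lia.
have g3 : 3 <= gamma.
  by apply: (inn3 (w (1 + i))); apply: inner; [apply: (o 1)|apply: (o 2)]; lia.
have g4' : 4 <= gamma.
  apply: (inn4 (w (2 + i))).
  by apply: not_in_S; [apply: (o 1)|apply: (o 2)|apply: (o 3)]; lia.
suff: source (w (4 + i)) \in B by rewrite (negPf (o 4 _)) //.
by apply: no4; [apply: (o 1)|apply: (o 2)|apply: (o 3)]; lia.
Qed.

Lemma saturate_out (S : {set darc D}) :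
  S \subset inner_arcs ->
  (forall v, #|[set a in S | source a == v]|
             <= #|[set a in arcs_from_B | target a == v]|) ->
  (forall v, #|[set a in inner_arcs | source a == v]|
             <= #|[set a in arcs_from_B | target a == v]|
                + #|[set a in S | target a == v]|) ->
  exists S' : {set darc D},
    [/\ S \subset S', S' \subset inner_arcs,
        forall v, #|[set a in S' | source a == v]|
                  <= #|[set a in arcs_from_B | target a == v]| &
        forall v, #|[set a in inner_arcs :\: S' | source a == v]|
                  <= #|[set a in S' | target a == v]|].
Proof.
move=> sSX degS degX.
pose P (A : {set darc D}) := (A \subset inner_arcs) &&
  [forall v, #|[set a in A | source a == v]|
             <= #|[set a in arcs_from_B | target a == v]|].
have PS : P S by rewrite /P sSX; apply/forallP.
have [S' /maxsetP[/andP[sS'X /forallP degS'] S'max] sSS'] := maxset_exists PS.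
exists S'; split=> // v.
have [->|[a]] := set_0Vmem [set a in inner_arcs :\: S' | source a == v].
  by rewrite cards0.
rewrite !inE => /andP[/andP[aS' aX] /eqP av].
have full : #|[set a in arcs_from_B | target a == v]|
            <= #|[set a in S' | source a == v]|.
  (* Adding [a] raises the out-count at [v] only, so room left there would contradict maximality. *)
  rewrite leqNgt; apply: contra aS' => lt.
  rewrite -[S'](S'max (a |: S')) ?setU11 ?subsetUr //.
  apply/andP; split; first by rewrite subUset sub1set inE aX.
  apply/forallP => u; have [->|uv] := eqVneq u v.
    apply: leq_trans lt.
    have -> : [set b in a |: S' | source b == v]
            = a |: [set b in S' | source b == v].
      apply/setP => b; rewrite !inE.
      by have [->|] := eqVneq b a; rewrite //= av eqxx.
    by rewrite cardsU1; case: (_ \notin _).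
  apply: leq_trans (degS' u); apply/subset_leq_card/subsetP => b.
  rewrite !inE => /andP[/orP[/eqP->|->//]]; rewrite av => /eqP vu.
  by rewrite vu eqxx in uv.
have split_out : #|[set a in inner_arcs | source a == v]| =
   #|[set a in S' | source a == v]| + #|[set a in inner_arcs :\: S' | source a == v]|.
  rewrite -(cardsID S'); congr (_ + _); apply: eq_card => b; rewrite !inE.
    have [bS'|] := boolP (b \in S'); rewrite ?andbF ?andbT //=.
    by have := subsetP sS'X b bS'; rewrite inE => ->.
  by rewrite andbA.
have inS : #|[set a in S | target a == v]| <= #|[set a in S' | target a == v]|.
  apply/subset_leq_card/subsetP => b; rewrite !inE => /andP[bS ->].
  by rewrite (subsetP sSS' b bS).
have := degX v; lia.
Qed.

(** * Reading the set [S] off a feasible solution *)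

Lemma late_time gamma (W : 'I_#|darc D| -> nat -> darc D) :
  (forall i, visits_regularly B gamma (W i)) ->
  exists N, forall i, exists2 n, n <= N & source (W i n) \in B.
Proof.
move=> Wvis.
have /fin_all_exists[F FP] i : exists k, source (W i k) \in B.
  by have [k _ kB] := (Wvis i).1 0; exists k.
by exists (\max_i F i) => i; exists (F i); first exact: leq_bigmax.
Qed.

Lemma feasible_inner_choice gamma :
  gamma <= 4 -> feasible B gamma ->
  exists S : {set darc D},
  [/\ S \subset inner_arcs,
   forall v, #|[set a in S | source a == v]|
             <= #|[set a in arcs_from_B | target a == v]|,
   forall v, #|[set a in inner_arcs | source a == v]|
             <= #|[set a in arcs_from_B | target a == v]|
                + #|[set a in S | target a == v]| &
   [/\ forall a : darc D, source a \notin B -> 2 <= gamma,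
   forall a, a \in inner_arcs -> 3 <= gamma &
   forall a, a \in inner_arcs :\: S -> 4 <= gamma]].
Proof.
move=> g4 [W [Wwalk Wvis Wbij]].
have [N Nlate] := late_time Wvis.
have WI t : injective (W^~ t) by case: (Wbij t).
have Wonto t a : exists i, W i t = a by case: (Wbij t).
(* Arcs may be counted as walks at any time [t], so comparing successive times relates arcs leaving
   [v] to arcs entering it. *)
have cardW t (Q : pred (darc D)) : #|[set a | Q a]| = #|[set i | Q (W i t)]|.
  rewrite -(card_imset _ (WI t)); apply: eq_card => a; rewrite inE.
  apply/idP/imsetP => [Qa|[i + ->]]; last by rewrite inE.
  by have [i iE] := Wonto t a; exists i; rewrite ?inE ?iE.
have out i t k : N <= t -> (forall l, l <= k -> source (W i (t + l)) \notin B) ->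
    k.+2 <= gamma.
  move=> Nt; apply: (outside_run_short (Wvis i)).
  by have [n nN nB] := Nlate i; exists n => //; apply: leq_trans nN Nt.
pose I := [set i | (W i N.+1 \in inner_arcs) && (source (W i N) \in B)].
pose S := [set W i N.+1 | i in I].
have memS i : (W i N.+1 \in S) = (i \in I) by rewrite mem_imset.
exists S; split.
- by apply/subsetP => a /imsetP[i + ->]; rewrite inE => /andP[].
- move=> v; rewrite (cardW N.+1) (cardW N).
  apply/subset_leq_card/subsetP => i; rewrite !inE memS inE Wwalk.
  by move=> /andP[/andP[_ ->] ->].
(* A walk on an inner arc out of [v] at [N.+2] entered [v] from [B] or by an inner arc. The latter
   is in [S]: otherwise four successive vertices avoid [B], forcing [gamma] to be at least 5. *)
- move=> v; rewrite (cardW N.+2) !(cardW N.+1) -cardsUI.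
  apply: leq_trans (leq_addr _ _); apply/subset_leq_card/subsetP => i.
  rewrite !inE memS !inE !Wwalk => /andP[/andP[o2 o3] ->]; rewrite !andbT o2 andbT.
  have [//|o1] := boolP (source (W i N.+1) \in B); apply/negPn/negP => o0.
  suff: 4.+1 <= gamma by rewrite ltnNge g4.
  by apply: (out i N 3) => // -[|[|[|[|//]]]] _; rewrite ?addn0 ?addn1 ?addn2 ?addn3.
split=> a.
- have [i <-] := Wonto N a => o0.
  by apply: (out i N 0) => // -[|//] _; rewrite addn0.
- have [i <-] := Wonto N a; rewrite inE Wwalk => /andP[o0 o1].
  by apply: (out i N 1) => // -[|[|//]] _; rewrite ?addn0 ?addn1.
- have [i <-] := Wonto N.+1 a; rewrite inE memS inE negb_and.
  move=> /andP[+ aX]; rewrite aX /= => o0.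
  move: aX; rewrite inE Wwalk => /andP[o1 o2].
  by apply: (out i N 2) => // -[|[|[|//]]] _; rewrite ?addn0 ?addn1 ?addn2.
Qed.

(** * Orbits of a permutation as closed trails *)

Lemma orbit_walks gamma (p : darc D -> darc D) :
  injective p -> (forall a, source (p a) = target a) ->
  (forall w, (forall k, w k.+1 = p (w k)) -> visits_regularly B gamma w) ->
  exists W : 'I_#|darc D| -> nat -> darc D,
    is_solution B gamma W /\ absolutely_periodic W.
Proof.
move=> pI psrc pvis.
have iterI j : injective (iter j p) by elim: j => //= j IH x y /pI /IH.
pose W (i : 'I_#|darc D|) k := iter k p (enum_val i).
exists W; split; first split=> [i|i|j].
- by move=> k; rewrite /W /= psrc.
- exact: pvis.
- split=> [i i' /iterI /enum_val_inj //|a].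
  (* The walk on [a] at time [j] starts [j] steps back along the orbit of [a]. *)
  exists (enum_rank (iter j (finv p) a)); rewrite /W enum_rankK.
  by elim: j => // j IH; rewrite iterSr iterS f_finv.
split=> [i|i i'].
- exists (order p (enum_val i)).
    by split=> [|k]; rewrite ?order_gt0 // /W iterD iter_order.
  move=> j k jp kp /(congr1 (findex p (enum_val i))).
  by rewrite /W !findex_iter.
- have [/iter_findex e|nc] := boolP (fconnect p (enum_val i) (enum_val i')).
    by right; exists (findex p (enum_val i) (enum_val i')) => k; rewrite /W iterD e.
  left=> j k e; case/negP: nc.
  apply: connect_trans (fconnect_iter p j _) _.
  by rewrite -/(W i j) e fconnect_sym // fconnect_iter.
Qed.

End Routing.

Theorem theorem1p1 (D : digraph) (B : {set vertex D}) (gamma : nat) :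
  eulerian D ->
  1 <= gamma ->
  gamma <= 4 ->
  feasible B gamma ->
  exists W : 'I_#|darc D| -> nat -> darc D,
    is_solution B gamma W /\ absolutely_periodic W.
Proof.
move=> eulD g1 g4 /(feasible_inner_choice g4)[S [sSX degS degX [out2 inn3 inn4]]].
have [S' [sSS' sS'X degS' degX']] := saturate_out sSX degS degX.
have [||p pI [psrc pvis]] := exists_routing eulD _ sS'X degS' degX' out2 inn3.
- by rewrite g1.
- by move=> a; rewrite inE => /andP[aS' aX]; apply: (inn4 a);
    rewrite inE aX andbT; apply: contra aS' => /(subsetP sSS').
exact: orbit_walks pI psrc pvis.
Qed.
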